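(* Let $H$ be a complex Hilbert space and let $A$ and $B$ be self-adjoint operators in $H$, at least one of which is positive, such that $D(A^2)=D(B^2)$. Let $T=A+iB$ (defined on $D(A)\cap D(B)$). If $T^2\subset 0$, then $T=0$ everywhere on $H$.
   Context: Products are taken on natural domains $D(ST)=\{x\in D(T):Tx\in D(S)\}$ and sums on $D(S+T)=D(S)\cap D(T)$. $T^2\subset 0$ means $T^2x=0$ for all $x\in D(T^2)$. A self-adjoint $A$ is positive if $\langle Ax,x\rangle\geq 0$ for all $x\in D(A)$. ''$T=0$ everywhere on $H$'' means $D(T)=H$ and $Tx=0$ for all $x\in H$. *)

(* Defs.v *)
From HB Require Import structures.
From mathcomp Require Import all_boot all_order all_algebra.
From mathcomp Require Import complex.
From mathcomp Require Import reals.
Set Implicit Arguments. Unset Strict Implicit. Unset Printing Implicit Defensive.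
Import Order.TTheory GRing.Theory Num.Theory.
Local Open Scope ring_scope.

Definition imag_unit (R : realType) : R[i] := Complex 0 1.

Section Hilbert.
Variables (R : realType) (H : lmodType R[i]).

Definition sqnorm (ip : H -> H -> R[i]) (x : H) : R := complex.Re (ip x x).

Record is_hilbert (ip : H -> H -> R[i]) : Prop := {
  ip_linl : forall (a : R[i]) (x y z : H), ip (a *: x + y) z = a * ip x z + ip y z;
  ip_conj : forall x y : H, ip y x = conjc (ip x y);
  ip_pos  : forall x : H, 0 <= ip x x;
  ip_def  : forall x : H, ip x x = 0 -> x = 0;
  ip_complete : forall u : nat -> H,
      (forall e : R, 0 < e -> exists N, forall m n, (N <= m)%N -> (N <= n)%N ->
          sqnorm ip (u m - u n) < e) ->
      exists l : H, forall e : R, 0 < e -> exists N, forall n, (N <= n)%N ->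
          sqnorm ip (u n - l) < e }.

(* (Possibly unbounded) linear operators "in H": a domain and an action;
   only the values on the domain are relevant. *)
Record op := Op { dom : H -> Prop; app : H -> H }.

Definition is_linear_op (T : op) : Prop :=
  dom T 0 /\
  (forall (a : R[i]) x y, dom T x -> dom T y ->
     dom T (a *: x + y) /\ app T (a *: x + y) = a *: app T x + app T y).

Definition op_add (S T : op) : op :=
  Op (fun x => dom S x /\ dom T x) (fun x => app S x + app T x).
Definition op_mul (S T : op) : op :=
  Op (fun x => dom T x /\ dom S (app T x)) (fun x => app S (app T x)).
Definition op_scale (a : R[i]) (T : op) : op :=
  Op (dom T) (fun x => a *: app T x).

Definition densely_defined (ip : H -> H -> R[i]) (T : op) : Prop :=
  forall x : H, forall e : R, 0 < e -> exists y, dom T y /\ sqnorm ip (x - y) < e.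

Definition adj_dom (ip : H -> H -> R[i]) (T : op) (y : H) : Prop :=
  exists z : H, forall x, dom T x -> ip (app T x) y = ip x z.

(* T self-adjoint: T densely defined and T^adj = T, i.e. D(T^adj) = D(T) and
   T^adj y = T y for y in D(T) (T^adj y is the unique z with <Tx,y> = <x,z>). *)
Definition self_adjoint (ip : H -> H -> R[i]) (T : op) : Prop :=
  is_linear_op T /\ densely_defined ip T /\
  (forall y, adj_dom ip T y <-> dom T y) /\
  (forall x y, dom T x -> dom T y -> ip (app T x) y = ip x (app T y)).

Definition positive_op (ip : H -> H -> R[i]) (T : op) : Prop :=
  forall x, dom T x -> 0 <= ip (app T x) x.

End Hilbert.

(* Main.v *)
(* The key point is D(A) = D(B).  Write P = 1 + A^2 and Q = 1 + B^2, two
   positive bijections from the common domain of A^2 and B^2 onto H.  Then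
   N = P^-1 Q is weakly bounded, hence bounded, by the uniform boundedness
   principle; since N is symmetric for the form <Px, y>, Krein's trick makes it
   bounded for that form too, i.e. |x|^2 + |Bx|^2 <= C (|x|^2 + |Ax|^2).  As
   D(A^2) is a core of A and B is closed, D(A) is contained in D(B), and
   conversely.
   So T^2 is defined on D(A^2), where T^2 = 0 reads F + iG = 0 with F = A^2 - B^2
   and G = AB + BA symmetric; hence F = G = 0.  If, say, A is positive, then
     0 <= <ABx, Bx> = - <BAx, Bx> = - <Ax, B^2 x> = - <Ax, A^2 x> <= 0,
   so A^2 x = 0 on D(A^2): P is the identity, D(A^2) = H, and A = B = 0.
   Only the separation of F and G involves the complex structure; the rest depends
   on Re <x, y> alone, so H is regarded there as a real Hilbert space. *)
Require Import Defs.
From HB Require Import structures.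
From mathcomp Require Import all_boot all_order all_algebra.
From mathcomp Require Import complex.
From mathcomp Require Import boolp classical_sets reals ring lra.
Set Implicit Arguments. Unset Strict Implicit. Unset Printing Implicit Defensive.
Import Order.TTheory GRing.Theory Num.Theory.
Local Open Scope ring_scope.

(** * Elementary inequalities over the reals *)

Lemma le0_of_small (R : realType) (a K : R) :
  0 <= K -> (forall e : R, 0 < e -> a <= K * e) -> a <= 0.
Proof.
move=> K0 h; rewrite leNgt; apply/negP => a0.
have K1 : 0 < K + 1 by lra.
(* For this e the bound K e equals a / 2 - e, which is less than a. *)
have e0 : 0 < a / (2 * (K + 1)) by rewrite divr_gt0 // mulr_gt0.
have := h _ e0.
have -> : K * (a / (2 * (K + 1))) = a / 2 - a / (2 * (K + 1)) by field; lra.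
lra.
Qed.

(** For b > 0, evaluate at the minimiser t = - c / b; for b = 0 the affine function stays
    nonnegative only if c = 0. Both Cauchy-Schwarz inequalities and the stationarity of a minimiser
    rest on it. *)
Lemma discriminant_le (R : realType) (a b c : R) : 0 <= b ->
  (forall t, 0 <= a + 2 * t * c + t ^+ 2 * b) -> c ^+ 2 <= a * b.
Proof.
move=> b0 h; move: b0; rewrite le_eqVlt => /predU1P[b0|b0]; last first.
  have := h (- c / b).
  have -> : a + 2 * (- c / b) * c + (- c / b) ^+ 2 * b = (a * b - c ^+ 2) / b.
    by field; lra.
  by rewrite pmulr_lge0 ?invr_gt0 // subr_ge0.
subst b; rewrite mulr0.
have [->|c0] := eqVneq c 0; first by rewrite expr0n.
(* At this t the affine function takes the value -1. *)
have := h (- (a + 1) / (2 * c)).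
have -> : a + 2 * (- (a + 1) / (2 * c)) * c + (- (a + 1) / (2 * c)) ^+ 2 * 0 = -1.
  by field.
by rewrite lerNr oppr0 ler10.
Qed.

Lemma inv_nat_small (R : realType) (e : R) : 0 < e ->
  exists N, forall n, (N <= n)%N -> n.+1%:R^-1 < e.
Proof.
move=> e0; exists (Num.truncn e^-1) => n hn.
rewrite invf_plt ?posrE // ?ltr0n //.
by apply: lt_le_trans (truncnS_gt _) _; rewrite ler_nat ltnS.
Qed.

Lemma bernoulli_ineq (R : realType) (q : R) n :
  1 <= q -> 1 + n%:R * (q - 1) <= q ^+ n.
Proof.
move=> q1; elim: n => [|n IH]; first by rewrite mul0r addr0.
have q0 : 0 <= q by lra.
rewrite exprS; apply: le_trans (ler_wpM2l q0 IH).
have := mulr_ge0 (ler0n R n) (sqr_ge0 (q - 1)).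
rewrite -natr1; set p := n%:R; lra.
Qed.

(** * Real Hilbert spaces and self-adjoint operators in them *)

Section RealHilbert.
Variables (R : realType) (V : lmodType R) (rip : V -> V -> R).

Local Notation sq x := (rip x x).

Record is_real_hilbert : Prop := {
  rip_linl : forall a x y z, rip (a *: x + y) z = a * rip x z + rip y z;
  rip_sym : forall x y, rip x y = rip y x;
  rip_ge0 : forall x, 0 <= sq x;
  rip_def : forall x, sq x = 0 -> x = 0;
  rip_complete : forall u : nat -> V,
    (forall e : R, 0 < e -> exists N, forall m n, (N <= m)%N -> (N <= n)%N ->
       sq (u m - u n) < e) ->
    exists l, forall e : R, 0 < e -> exists N, forall n, (N <= n)%N ->
       sq (u n - l) < e }.

(** [sa_adj] says that D(A^adj) is contained in D(A); the other inclusion follows from [sa_sym]. *)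
Record is_self_adjoint (D : V -> Prop) (A : V -> V) : Prop := {
  sa_0 : D 0;
  sa_lin : forall a x y, D x -> D y ->
    D (a *: x + y) /\ A (a *: x + y) = a *: A x + A y;
  sa_dense : forall x (e : R), 0 < e -> exists2 y, D y & sq (x - y) < e;
  sa_sym : forall x y, D x -> D y -> rip (A x) y = rip x (A y);
  sa_adj : forall y z, (forall x, D x -> rip (A x) y = rip x z) -> D y }.

Hypothesis hV : is_real_hilbert.

Lemma ripDl x y z : rip (x + y) z = rip x z + rip y z.
Proof. by have := rip_linl hV 1 x y z; rewrite scale1r mul1r. Qed.
Lemma rip0l z : rip 0 z = 0.
Proof. by have := ripDl 0 0 z; rewrite addr0 => h; lra. Qed.
Lemma ripZl a x z : rip (a *: x) z = a * rip x z.
Proof. by have := rip_linl hV a x 0 z; rewrite addr0 rip0l addr0. Qed.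
Lemma ripNl x z : rip (- x) z = - rip x z.
Proof. by rewrite -scaleN1r ripZl mulN1r. Qed.
Lemma ripBl x y z : rip (x - y) z = rip x z - rip y z.
Proof. by rewrite ripDl ripNl. Qed.
Lemma ripDr x y z : rip z (x + y) = rip z x + rip z y.
Proof. by rewrite !(rip_sym hV z) ripDl. Qed.
Lemma ripZr a x z : rip z (a *: x) = a * rip z x.
Proof. by rewrite !(rip_sym hV z) ripZl. Qed.
Lemma ripNr x z : rip z (- x) = - rip z x.
Proof. by rewrite !(rip_sym hV z) ripNl. Qed.
Lemma ripBr x y z : rip z (x - y) = rip z x - rip z y.
Proof. by rewrite ripDr ripNr. Qed.

Definition ripE := (ripDl, ripNl, ripZl, ripDr, ripNr, ripZr).

Lemma sqN x : sq (- x) = sq x.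
Proof. by rewrite ripNl ripNr opprK. Qed.
Lemma sqB x y : sq (x - y) = sq (y - x).
Proof. by rewrite -sqN opprB. Qed.

Lemma cauchy_schwarz x y : rip x y ^+ 2 <= sq x * sq y.
Proof.
apply: discriminant_le => [|t]; first exact: rip_ge0.
apply: le_trans (rip_ge0 hV (x + t *: y)) _.
by rewrite !ripE (rip_sym hV y x) le_eqVlt; apply/orP; left; apply/eqP; ring.
Qed.

Lemma sqD_le x y : sq (x + y) <= 2 * sq x + 2 * sq y.
Proof.
have := rip_ge0 hV (x - y).
rewrite !ripE (rip_sym hV y x); lra.
Qed.

Lemma sqB_le z x y : sq (x - y) <= 2 * sq (x - z) + 2 * sq (y - z).
Proof. by rewrite (sqB y) -[x - y](subrKA z); apply: sqD_le. Qed.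

(** All limits below are taken of sequences whose squared distances obey such a rate. *)
Lemma cauchy_rate (u : nat -> V) (c : R) : 0 <= c ->
  (forall m n, sq (u m - u n) <= c * (m.+1%:R^-1 + n.+1%:R^-1)) ->
  exists l, forall e : R, 0 < e -> exists N, forall n, (N <= n)%N ->
    sq (u n - l) < e.
Proof.
move=> c0 hu; apply: (rip_complete hV) => e e0.
have c1 : 0 < 2 * (c + 1) by lra.
have [N hN] := inv_nat_small (divr_gt0 e0 c1).
exists N => m n /hN hm /hN hn; apply: le_lt_trans (hu m n) _.
rewrite !ltr_pdivlMr // in hm hn.
have := invr_ge0 (m.+1%:R : R); have := invr_ge0 (n.+1%:R : R).
rewrite !ler0n => hn0 hm0; move: hn hm hn0 hm0.
set p := m.+1%:R^-1; set q := n.+1%:R^-1 => *; nra.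
Qed.

(** * The norm and the uniform boundedness principle *)

Definition nrm x := Num.sqrt (sq x).

Lemma nrm_ge0 x : 0 <= nrm x. Proof. exact: sqrtr_ge0. Qed.
Lemma nrm_sqr x : nrm x ^+ 2 = sq x. Proof. by rewrite sqr_sqrtr // rip_ge0. Qed.
Lemma nrmB x y : nrm (x - y) = nrm (y - x). Proof. by rewrite /nrm sqB. Qed.
Lemma nrmZ a x : nrm (a *: x) = `|a| * nrm x.
Proof. by rewrite /nrm ripZl ripZr mulrA -expr2 sqrtrM ?sqr_ge0 // sqrtr_sqr. Qed.

Lemma rip_le_nrm x y : `|rip x y| <= nrm x * nrm y.
Proof.
rewrite -ler_sqr ?nnegrE ?mulr_ge0 ?nrm_ge0 // real_normK ?num_real //.
by rewrite exprMn !nrm_sqr; apply: cauchy_schwarz.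
Qed.

Lemma nrmD_le x y : nrm (x + y) <= nrm x + nrm y.
Proof.
rewrite -ler_sqr ?nnegrE ?addr_ge0 ?nrm_ge0 // sqrrD !nrm_sqr !ripE (rip_sym hV y x).
have := le_trans (ler_norm _) (rip_le_nrm x y); lra.
Qed.

Lemma nrmB_le z x y : nrm (x - y) <= nrm (x - z) + nrm (z - y).
Proof. by rewrite -[x - y](subrKA z); apply: nrmD_le. Qed.

(* Sokal's gliding hump: a step of length 3^-n towards or away from w_n makes
   the pairing with w_n large, and the later steps, of total length 3^-n / 2,
   destroy at most half of it. *)
Lemma weakly_bounded (W : V -> Prop) :
  (forall x, exists M, forall w, W w -> rip x w ^+ 2 <= M) ->
  exists C, forall w, W w -> sq w <= C.
Proof.
move=> hW; apply: contrapT => nC.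
pose d n : R := 3^-1 ^+ n.
have d0 n : 0 < d n by rewrite exprn_gt0 // invr_gt0.
have dS n : d n.+1 = d n / 3 by rewrite /d exprSr.
have /choice[h hh] n : exists w, W w /\ (2 * n%:R / d n) ^+ 2 < sq w.
  apply: contrapT => nw; apply: nC; exists ((2 * n%:R / d n) ^+ 2) => w hw.
  by rewrite leNgt; apply/negP => lw; apply: nw; exists w.
have hn n : 2 * n%:R < d n * nrm (h n).
  rewrite -ltr_pdivrMl // mulrC; have [_] := hh n.
  rewrite -nrm_sqr ltr_sqr ?nnegrE ?nrm_ge0 //.
  by rewrite divr_ge0 ?mulr_ge0 ?ler0n // ltW.
have h0 n : 0 < nrm (h n).
  by rewrite -(pmulr_rgt0 _ (d0 n)); apply: le_lt_trans (hn n); rewrite mulr_ge0 ?ler0n.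
(* The sign makes the step add to the pairing with [h n] instead of cancelling it. *)
pose eps n x : R := if 0 <= rip x (h n) then 1 else -1.
pose step n x := x + (eps n x * d n / nrm (h n)) *: h n.
pose X n := iteri n step 0.
have XS n : X n.+1 = step n (X n) by [].
have neps n x : `|eps n x| = 1 by rewrite /eps; case: ifP; rewrite ?normrN normr1.
have near1 n : nrm (X n.+1 - X n) = d n.
  rewrite XS /step addrAC subrr add0r nrmZ !normrM neps mul1r normfV.
  by rewrite !ger0_norm ?nrm_ge0 ?(ltW (d0 n)) // divfK // lt0r_neq0.
have far n : d n * nrm (h n) <= `|rip (X n.+1) (h n)|.
  rewrite XS /step ripDl ripZl -nrm_sqr.
  have -> : eps n (X n) * d n / nrm (h n) * nrm (h n) ^+ 2
      = eps n (X n) * (d n * nrm (h n)) by field; rewrite lt0r_neq0.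
  have p0 := mulr_gt0 (d0 n) (h0 n).
  rewrite /eps; case: (leP 0 (rip (X n) (h n))) => r0.
    by rewrite mul1r ger0_norm; lra.
  by rewrite mulN1r ltr0_norm; lra.
(* The right-hand side is the geometric sum d_n + ... + d_(n+k-1). *)
have nearD n k : nrm (X (n + k)%N - X n) <= 3 / 2 * (d n - d (n + k)%N).
  elim: k => [|k IH]; first by rewrite addn0 !subrr mulr0 /nrm rip0l sqrtr0.
  rewrite addnS dS; have := nrmB_le (X (n + k)%N) (X (n + k).+1) (X n).
  rewrite near1; lra.
have near n m : (n <= m)%N -> nrm (X m - X n) <= 3 / 2 * d n.
  move=> /subnKC <-; have := nearD n (m - n)%N; have := d0 (n + (m - n))%N; lra.
have dn n : d n <= n.+1%:R^-1.
  rewrite /d exprVn lef_pV2 ?posrE ?ltr0n ?exprn_gt0 // -natrX ler_nat.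
  by rewrite ltn_expl.
have dn1 n : d n <= 1 by apply: exprn_ile1; lra.
have rate n m : (n <= m)%N -> sq (X m - X n) <= 9 / 4 * n.+1%:R^-1.
  move=> /near lnm; rewrite -nrm_sqr; apply: le_trans (_ : (3 / 2 * d n) ^+ 2 <= _).
    by rewrite ler_sqr ?nnegrE ?nrm_ge0 //; have := d0 n; lra.
  have := dn n; have := dn1 n; have := d0 n; set p := _^-1; nra.
have inv0 n : 0 <= n.+1%:R^-1 :> R by rewrite invr_ge0 ler0n.
have [x hx] : exists l, forall e : R, 0 < e -> exists N, forall n, (N <= n)%N ->
    sq (X n - l) < e.
  apply: (@cauchy_rate _ (9 / 4)) => [|m n]; first lra.
  have := inv0 m; have := inv0 n.
  case: (leqP n m) => [|/ltnW] /rate; last rewrite sqB.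
    by set p := m.+1%:R^-1; set q := n.+1%:R^-1; lra.
  by set p := m.+1%:R^-1; set q := n.+1%:R^-1; lra.
have lim n : nrm (x - X n.+1) <= d n / 2.
  apply/ler_addgt0Pr => e e0.
  have [N hN] := hx _ (exprn_gt0 2 e0).
  have h1 : nrm (x - X (N + n.+1)%N) < e.
    rewrite nrmB -ltr_sqr ?nnegrE ?nrm_ge0 ?(ltW e0) // nrm_sqr.
    by apply: hN; rewrite leq_addr.
  have := near n.+1 (N + n.+1)%N (leq_addl _ _); rewrite dS.
  have := nrmB_le (X (N + n.+1)%N) x (X n.+1); lra.
have [M hM] := hW x.
(* The pairing of [X n.+1] with [h n] is at least d_n |h_n|; passing to the limit costs at most half
   of it, and d_n |h_n| / 2 > n. *)
have big n : n%:R < `|rip x (h n)|.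
  have := far n; have := hn n.
  have -> : rip (X n.+1) (h n) = rip x (h n) - rip (x - X n.+1) (h n).
    by rewrite ripBl opprB addrC subrK.
  have := ler_normB (rip x (h n)) (rip (x - X n.+1) (h n)).
  have := rip_le_nrm (x - X n.+1) (h n).
  have : nrm (x - X n.+1) * nrm (h n) <= d n / 2 * nrm (h n).
    by rewrite ler_wpM2r ?nrm_ge0.
  lra.
have [n hn'] : exists n : nat, M < n.+1%:R.
  by exists (Num.truncn M); apply: truncnS_gt.
have := big n.+1; have [+ _] := hh n.+1 => /hM.
rewrite -real_normK ?num_real // => h1 h2.
have n1 : 1 <= n.+1%:R :> R by rewrite ler1n.
move: h1 h2 hn' n1; set p := `|_|; set q := n.+1%:R; nra.
Qed.

(** * Closedness, the resolvent of the square, and a core *)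

Section Operator.
Variables (D : V -> Prop) (A : V -> V).
Hypothesis hA : is_self_adjoint D A.

Lemma saD x y : D x -> D y -> D (x + y) /\ A (x + y) = A x + A y.
Proof. by move=> dx dy; have := sa_lin hA 1 dx dy; rewrite !scale1r. Qed.
Lemma saO : A 0 = 0.
Proof.
have [_] := saD (sa_0 hA) (sa_0 hA); rewrite addr0 => /eqP.
by rewrite -subr_eq subrr => /eqP.
Qed.
Lemma saZ a x : D x -> D (a *: x) /\ A (a *: x) = a *: A x.
Proof. by move=> dx; have := sa_lin hA a dx (sa_0 hA); rewrite saO !addr0. Qed.
Lemma saB x y : D x -> D y -> D (x - y) /\ A (x - y) = A x - A y.
Proof.
move=> dx dy; have [dz ez] := saZ (-1) dy.
by have := saD dx dz; rewrite ez !scaleN1r.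
Qed.

(** The difference v = z - w is orthogonal to D, so |v|^2 = <v - y, v> for y in D, which is small
    when y is close to v. *)
Lemma orth_dense z w : (forall h, D h -> rip h z = rip h w) -> z = w.
Proof.
move=> h; apply/eqP; rewrite -subr_eq0; apply/eqP/(rip_def hV)/le_anti.
rewrite rip_ge0 // andbT.
set v := z - w; have hv y : D y -> rip y v = 0.
  by move=> dy; rewrite ripBr h // subrr.
suff : sq v ^+ 2 <= 0.
  by rewrite expr2 leNgt => h0; rewrite leNgt; apply: contra h0 => ?; apply: mulr_gt0.
apply: (@le0_of_small _ _ (sq v)); first exact: rip_ge0.
move=> e /(sa_dense hA v) [y dy hy].
have := cauchy_schwarz (v - y) v.
rewrite ripBl (hv _ dy) subr0 => /le_trans; apply.
by rewrite mulrC ler_wpM2l ?rip_ge0 // ltW.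
Qed.

(** The identity <Ah, u> = <h, Au> passes to the limit <Ah, x> = <h, y>, which puts x in D(A^adj) =
    D(A). *)
Lemma sa_closed x y :
  (forall e : R, 0 < e -> exists u, [/\ D u, sq (u - x) < e & sq (A u - y) < e]) ->
  D x /\ A x = y.
Proof.
move=> hc.
have key h : D h -> rip (A h) x = rip h y.
  move=> dh; apply/eqP; rewrite -subr_eq0 -sqrf_eq0 eq_le sqr_ge0 andbT.
  apply: (@le0_of_small _ _ (2 * sq (A h) + 2 * sq h)).
    by rewrite addr_ge0 // mulr_ge0 // rip_ge0.
  move=> e /hc[u [du h1 h2]].
  have -> : rip (A h) x - rip h y = rip h (A u - y) - rip (A h) (u - x).
    by rewrite !ripBr (sa_sym hA dh du); ring.
  have c1 := cauchy_schwarz h (A u - y).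
  have c2 := cauchy_schwarz (A h) (u - x).
  have b1 : sq h * sq (A u - y) <= sq h * e by rewrite ler_wpM2l ?rip_ge0 // ltW.
  have b2 : sq (A h) * sq (u - x) <= sq (A h) * e by rewrite ler_wpM2l ?rip_ge0 // ltW.
  set p := rip h _ in c1 *; set q := rip (A h) _ in c2 *.
  have := sqr_ge0 (p + q); rewrite sqrrD sqrrB; lra.
have dx := sa_adj hA key; split=> //.
by apply: orth_dense => h dh; rewrite -(sa_sym hA dh dx) key.
Qed.

(** Direct method: minimise |x - y|^2 + s |Ax|^2 over D(A). Minimising sequences converge in the
    graph norm, and the Euler-Lagrange equation puts Ax in D(A^adj) = D(A). *)
Lemma resolvent_exists (s : R) (y : V) : 0 < s ->
  exists x, [/\ D x, D (A x) & x + s *: A (A x) = y].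
Proof.
move=> s0; pose F x := sq (x - y) + s * sq (A x).
have F0 x : 0 <= F x by rewrite addr_ge0 ?mulr_ge0 ?rip_ge0 // ltW.
pose E : set R := fun r => exists2 x, D x & F x = r.
have lbE : lbound E 0 by move=> _ [x _ <-].
have infE : has_inf E.
  by split; [exists (F 0); exists 0; first exact: sa_0 hA | exists 0].
pose m := inf E.
have hm x : D x -> m <= F x by move=> dx; apply: ge_inf; [exists 0 | exists x].
have /choice[u hu] n : exists x, D x /\ F x < m + n.+1%:R^-1.
  have n0 : 0 < n.+1%:R^-1 :> R by rewrite invr_gt0 ltr0n.
  by have [_ [x dx <-] hx] := inf_adherent n0 infE; exists x.
have du n : D (u n) by case: (hu n).
have Fu n : F (u n) < m + n.+1%:R^-1 by case: (hu n).
(* Parallelogram law, with [F] at the midpoint of v and w bounded below by m. *)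
have par v w : D v -> D w ->
    sq (v - w) + s * sq (A v - A w) <= 2 * (F v - m) + 2 * (F w - m).
  move=> dv dw; have [dvw evw] := saD dv dw.
  have [dz ez] := saZ 2^-1 dvw; have := hm _ dz.
  rewrite /F ez evw !ripE !(rip_sym hV y) (rip_sym hV w v) (rip_sym hV (A w) (A v)).
  lra.
have [x hx] : exists l, forall e : R, 0 < e -> exists N, forall n, (N <= n)%N ->
    sq (u n - l) < e.
  apply: (@cauchy_rate _ 2) => // i j.
  have := par _ _ (du i) (du j).
  have : 0 <= s * sq (A (u i) - A (u j)) by rewrite mulr_ge0 ?rip_ge0 // ltW.
  have := Fu i; have := Fu j.
  set p := i.+1%:R^-1; set q := j.+1%:R^-1; lra.
have [z hz] : exists l, forall e : R, 0 < e -> exists N, forall n, (N <= n)%N ->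
    sq (A (u n) - l) < e.
  apply: (@cauchy_rate _ (2 / s)) => [|i j]; first by rewrite divr_ge0 // ltW.
  rewrite mulrAC ler_pdivlMr // mulrC.
  have := par _ _ (du i) (du j).
  have : 0 <= sq (u i - u j) by rewrite rip_ge0.
  have := Fu i; have := Fu j.
  set p := i.+1%:R^-1; set q := j.+1%:R^-1; lra.
have hc e : 0 < e -> exists v, [/\ D v, sq (v - x) < e, sq (A v - z) < e & F v < m + e].
  move=> e0; have [N1 h1] := hx _ e0; have [N2 h2] := hz _ e0.
  have [N3 h3] := inv_nat_small e0.
  exists (u (N1 + N2 + N3)%N); split=> //; [apply: h1 | apply: h2 |].
  - by rewrite -addnA leq_addr.
  - by rewrite addnAC leq_addl.
  - by apply: lt_trans (Fu _) _; rewrite ltrD2l h3 // leq_addl.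
have [dx ez] : D x /\ A x = z.
  by apply: sa_closed => e /hc[v [? ? ? _]]; exists v.
(* Weak Euler-Lagrange equation, obtained from almost minimisers v near x, so that F x = m need not
   be established. *)
have stat h : D h -> rip (A h) (A x) = rip h (s^-1 *: (y - x)).
  move=> dh; set L := rip (x - y) h + s * rip (A x) (A h).
  suff : L = 0.
    rewrite /L ripZr (rip_sym hV h) !ripBl (rip_sym hV (A h)) => L0.
    by apply: (mulfI (lt0r_neq0 s0)); rewrite mulrA mulfV ?lt0r_neq0 // mul1r; lra.
  apply/eqP; rewrite -sqrf_eq0 eq_le sqr_ge0 andbT.
  pose q := sq h + s * sq (A h).
  have sqh := rip_ge0 hV h; have sqAh := rip_ge0 hV (A h).
  have q0 : 0 <= q by rewrite addr_ge0 ?mulr_ge0 // ltW.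
  apply: (@le0_of_small _ _ (3 * q + 3 * sq h + 3 * (s ^+ 2 * sq (A h)))).
    have := mulr_ge0 (sqr_ge0 s) sqAh; lra.
  move=> e /hc[v [dv h1 h2 h3]].
  set Lv := rip (v - y) h + s * rip (A v) (A h).
  (* The polynomial F (v + t h) - m = (F v - m) + 2 t Lv + t^2 q is nonnegative in t. *)
  have bv : Lv ^+ 2 <= (F v - m) * q.
    apply: discriminant_le => // t.
    have [dth eth] := saZ t dh; have [dw ew] := saD dv dth.
    have := hm _ dw; rewrite /F ew eth /q /Lv !ripE !(rip_sym hV y) !(rip_sym hV h).
    rewrite !(rip_sym hV (A h)); lra.
  have bv' : Lv ^+ 2 <= e * q by apply: le_trans bv _; rewrite ler_wpM2r //; lra.
  have c1 := cauchy_schwarz (v - x) h; have c2 := cauchy_schwarz (A v - A x) (A h).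
  have b1 : rip (v - x) h ^+ 2 <= e * sq h.
    by apply: le_trans c1 _; rewrite ler_wpM2r // ltW.
  have b2 : rip (A v - A x) (A h) ^+ 2 <= e * sq (A h).
    by apply: le_trans c2 _; rewrite ler_wpM2r // ez ltW.
  have -> : L = Lv - rip (v - x) h - s * rip (A v - A x) (A h).
    by rewrite /L /Lv !ripBl; ring.
  have b3 : (s * rip (A v - A x) (A h)) ^+ 2 <= s ^+ 2 * (e * sq (A h)).
    by rewrite exprMn ler_wpM2l // sqr_ge0.
  move: bv' b1 b3; set p1 := rip (v - x) h; set p2 := s * rip _ _ => b0 b1 b3.
  have := sqr_ge0 (Lv + p1); have := sqr_ge0 (Lv + p2); have := sqr_ge0 (p1 - p2).
  lra.
have dAx := sa_adj hA stat.
exists x; split=> //; suff -> : A (A x) = s^-1 *: (y - x).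
  by rewrite scalerA mulfV ?lt0r_neq0 // scale1r addrC subrK.
by apply: orth_dense => h dh; rewrite -(sa_sym hA dh dAx) stat.
Qed.

(** Expanding, |z|^2 = |v|^2 + 2 s |Av|^2 + s^2 |A^2 v|^2. *)
Lemma resolvent_contract (s : R) v z : 0 < s -> D v -> D (A v) ->
  v + s *: A (A v) = z -> sq v <= sq z.
Proof.
move=> s0 dv dAv <-; rewrite !ripE (rip_sym hV (A (A v)) v).
rewrite -(sa_sym hA dv dAv).
have := mulr_ge0 (ltW s0) (rip_ge0 hV (A v)).
have := rip_ge0 hV (s *: A (A v)); rewrite !ripE; lra.
Qed.

(** As z - w = s A^2 w, |z - w|^2 = s (<Az, Aw> - |Aw|^2), and |Az - 2 Aw|^2 >= 0 bounds the bracket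
    by |Az|^2 / 4. *)
Lemma resolvent_rate (s : R) w z : 0 < s -> D z -> D w -> D (A w) ->
  w + s *: A (A w) = z -> 4 * sq (z - w) <= s * sq (A z).
Proof.
move=> s0 dz dw dAw ez; have [dzw ezw] := saB dz dw.
have -> : sq (z - w) = s * (rip (A z) (A w) - sq (A w)).
  have {2}-> : z - w = s *: A (A w) by rewrite -ez addrAC subrr add0r.
  by rewrite ripZr -(sa_sym hA dzw dAw) ezw ripBl.
have := mulr_ge0 (ltW s0) (rip_ge0 hV (A z - 2 *: A w)).
rewrite !ripE (rip_sym hV (A w) (A z)); lra.
Qed.

(** Take x = (1 + s A^2)^-1 x0 with s small. Then Ax = (1 + s A^2)^-1 A x0, but A x0 may lie outside
    D(A), so it is compared with a nearby z in D(A) and its resolvent w. *)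
Lemma square_core x0 e : D x0 -> 0 < e ->
  exists x, [/\ D x, D (A x), sq (x - x0) < e & sq (A x - A x0) < e].
Proof.
(* The final error is at most 6 |A x0 - z|^2 + 4 |z - w|^2; the first term takes e / 2, and the
   choice of [K] keeps s |Az|^2 below e / 2. *)
move=> dx0 e0; have e1 : 0 < e / 12 by lra.
have [z dz hz] := sa_dense hA (A x0) e1.
have n1 := rip_ge0 hV (A z); have n2 := rip_ge0 hV (A x0).
pose K := 2 * (sq (A z) + sq (A x0) + 1).
have K0 : 0 < K by rewrite /K; lra.
have [s s0 sK] : exists2 s, 0 < s & s * K = e.
  by exists (e / K); rewrite ?divr_gt0 ?divfK ?lt0r_neq0.
rewrite /K in sK.
have [x [dx dAx ex]] := resolvent_exists x0 s0.
have [w [dw dAw ew]] := resolvent_exists z s0.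
have rx := resolvent_rate s0 dx0 dx dAx ex.
have rw := resolvent_rate s0 dz dw dAw ew.
have m1 := mulr_ge0 (ltW s0) n1; have m2 := mulr_ge0 (ltW s0) n2.
exists x; split=> //; first by rewrite sqB; lra.
have eAA : s *: A (A x) = x0 - x by rewrite -ex addrAC subrr add0r.
have dAAx : D (A (A x)).
  have -> : A (A x) = s^-1 *: (x0 - x).
    by rewrite -eAA scalerA mulVf ?scale1r // lt0r_neq0.
  by have [d _] := saB dx0 dx; have [] := saZ s^-1 d.
have eAx : A x + s *: A (A (A x)) = A x0.
  have [_ <-] := saZ s dAAx; have [d _] := saZ s dAAx.
  by rewrite -ex; have [_ ->] := saD dx d.
have [d1 f1] := saB dAx dw; have [d2 f2] := saB dAAx dAw.
have ct : sq (A x - w) <= sq (A x0 - z).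
  apply: (resolvent_contract s0) => //; first by rewrite f1.
  by rewrite f1 f2 scalerBr addrACA -opprD eAx ew.
have := sqB_le z (A x) (A x0); have := sqB_le w (A x) z.
lra.
Qed.

End Operator.

(** * Operators symmetric for a positive form *)

Section PositiveForm.
Variables (E : V -> Prop) (P : V -> V).
Hypothesis P_lin : forall a x y, E x -> E y ->
  E (a *: x + y) /\ P (a *: x + y) = a *: P x + P y.
Hypothesis P_sym : forall x y, E x -> E y -> rip (P x) y = rip x (P y).
Hypothesis P_ge0 : forall x, E x -> 0 <= rip (P x) x.

Lemma form_cauchy_schwarz x y : E x -> E y ->
  rip (P x) y ^+ 2 <= rip (P x) x * rip (P y) y.
Proof.
move=> ex ey; apply: discriminant_le => [|t]; first exact: P_ge0.
have [ez pz] := P_lin t ey ex.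
have := P_ge0 ez; rewrite pz !ripE (P_sym ey ex) (rip_sym hV y); lra.
Qed.

(* Krein: the moments c_n of N at x for the form satisfy c_n^2 <= c_0 c_2n, so
   c_1 > C c_0 would make c_(2^k) grow faster than C^(2^k). *)
Lemma krein (N : V -> V) (C : R) : 0 < C ->
  (forall x, E x -> E (N x)) ->
  (forall x y, E x -> E y -> rip (P (N x)) y = rip (P x) (N y)) ->
  (forall x, E x -> sq (N x) <= C ^+ 2 * sq x) ->
  forall x, E x -> rip (P (N x)) x <= C * rip (P x) x.
Proof.
move=> C0 EN N_sym N_bd x ex.
have [K KE K0] : exists2 K, C ^+ 2 = K & 0 < K.
  by exists (C ^+ 2); rewrite ?exprn_gt0.
rewrite KE in N_bd.
have ei n : E (iter n N x) by elim: n => //= n; apply: EN.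
pose c n := rip (P x) (iter n N x).
have cD i j : rip (P (iter i N x)) (iter j N x) = c (i + j)%N.
  by elim: i j => // i IH j; rewrite iterS N_sym // -iterS IH addnS.
have c_cs n : c n ^+ 2 <= c 0 * c (n + n)%N.
  by rewrite -cD; apply: form_cauchy_schwarz.
(* The assumed norm bound on N limits the growth of the moments to C^n. *)
have c_bd n : c n ^+ 2 <= sq (P x) * sq x * K ^+ n.
  apply: le_trans (cauchy_schwarz _ _) _.
  rewrite -mulrA ler_wpM2l ?rip_ge0 // mulrC.
  elim: n => [|n IH]; first by rewrite mul1r.
  apply: le_trans (N_bd _ (ei n)) _.
  by rewrite exprS -mulrA ler_wpM2l // ltW.
rewrite N_sym // leNgt; apply/negP; rewrite -/(c 0) -/(c 1) => c1.
have c00 : 0 < c 0.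
  have : 0 <= c 0 := P_ge0 ex; rewrite le_eqVlt => /predU1P[c00|//].
  move: (c_cs 1) c1; rewrite -c00 mul0r mulr0 => h1 h2.
  by have := exprn_gt0 2 h2; lra.
pose r := c 1 / c 0.
have rC : C < r by rewrite ltr_pdivlMr.
have r0 : 0 < r by lra.
have grow k : c 0 * r ^+ (2 ^ k) <= c (2 ^ k)%N.
  elim: k => [|k IH]; first by rewrite expr1 /r mulrC divfK // lt0r_neq0.
  rewrite expnS mul2n -addnn exprD.
  rewrite -(ler_pM2l c00); apply: le_trans (c_cs _).
  have p0 : 0 <= c 0 * r ^+ (2 ^ k) by rewrite mulr_ge0 ?exprn_ge0 // ltW.
  rewrite mulrA mulrCA -expr2.
  by rewrite ler_sqr ?nnegrE // (le_trans p0 IH).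
(* Comparing both growth rates keeps q^(2^n) bounded although q > 1; Bernoulli's inequality refutes
   this. *)
pose q := r ^+ 2 / K.
have q1 : 1 < q.
  by rewrite ltr_pdivlMr // mul1r -KE ltr_sqr ?nnegrE // ltW.
have bd n : c 0 ^+ 2 * q ^+ (2 ^ n) <= sq (P x) * sq x.
  rewrite -(ler_pM2r (exprn_gt0 (2 ^ n) K0)); apply: le_trans (c_bd _).
  rewrite -mulrA -exprMn divfK ?lt0r_neq0 // exprAC -exprMn.
  by rewrite ler_sqr ?nnegrE // ?(le_trans _ (grow n)) // mulr_ge0 ?exprn_ge0 // ltW.
have c2 : 0 < c 0 ^+ 2 * (q - 1) by rewrite mulr_gt0 ?exprn_gt0 // subr_gt0.
pose n := Num.truncn (sq (P x) * sq x / (c 0 ^+ 2 * (q - 1))).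
have := truncnS_gt (sq (P x) * sq x / (c 0 ^+ 2 * (q - 1))).
apply/negP; rewrite -leNgt -/n ler_pdivlMr // mulrC; apply: le_trans (bd n).
rewrite -mulrA ler_pM2l ?exprn_gt0 //; apply: le_trans (bernoulli_ineq _ (ltW q1)).
have : n.+1%:R <= (2 ^ n)%:R :> R by rewrite ler_nat ltn_expl.
set p := n.+1%:R; set p2 := (2 ^ n)%:R; nra.
Qed.

End PositiveForm.

(** * The operators 1 + A^2 and 1 + B^2, and the inclusion of D(A) in D(B) *)

Lemma square_lin (D : V -> Prop) (A : V -> V) : is_self_adjoint D A ->
  forall a x y, D x /\ D (A x) -> D y /\ D (A y) ->
  (D (a *: x + y) /\ D (A (a *: x + y))) /\
  a *: x + y + A (A (a *: x + y)) = a *: (x + A (A x)) + (y + A (A y)).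
Proof.
move=> hA a x y [dx dAx] [dy dAy].
have [d1 e1] := sa_lin hA a dx dy; have [d2 e2] := sa_lin hA a dAx dAy.
by rewrite e1 e2 scalerDr addrACA.
Qed.

Lemma square_rip (D : V -> Prop) (A : V -> V) : is_self_adjoint D A ->
  forall x y, D x -> D (A x) -> D y ->
  rip (x + A (A x)) y = rip x y + rip (A x) (A y).
Proof. by move=> hA x y _ dAx dy; rewrite ripDl (sa_sym hA dAx dy). Qed.

Section Inclusion.
Variables (DA DB : V -> Prop) (A B : V -> V).
Hypotheses (hA : is_self_adjoint DA A) (hB : is_self_adjoint DB B).
Hypothesis sAB : forall x, DA x -> DA (A x) -> DB x /\ DB (B x).

Lemma square_form_bound : exists2 C : R, 0 <= C & forall x, DA x -> DA (A x) ->
  sq x + sq (B x) <= C * (sq x + sq (A x)).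
Proof.
pose E x := DA x /\ DA (A x); pose P x := x + A (A x); pose Q x := x + B (B x).
have P_rip x y : E x -> DA y -> rip (P x) y = rip x y + rip (A x) (A y).
  by case=> dx dAx; apply: square_rip.
have P_sym x y : E x -> E y -> rip (P x) y = rip x (P y).
  move=> ex ey; have [dx _] := ex; have [dy _] := ey.
  rewrite (rip_sym hV x) !P_rip //.
  by rewrite (rip_sym hV x) (rip_sym hV (A x)).
have Q_rip : forall x y, E x -> E y -> rip (Q x) y = rip x y + rip (B x) (B y).
  move=> x y [dx dAx] [dy dAy].
  have [? ?] := sAB dx dAx; have [? _] := sAB dy dAy.
  exact: (square_rip hB).
have Q_sym x y : E x -> E y -> rip (Q x) y = rip x (Q y).
  move=> ex ey; rewrite (rip_sym hV x) !Q_rip //.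
  by rewrite (rip_sym hV x) (rip_sym hV (B x)).
have P_ge0 x : E x -> 0 <= rip (P x) x.
  by move=> ex; have [dx _] := ex; rewrite P_rip // addr_ge0 ?rip_ge0.
have P_onto x : exists y, E y /\ P y = x.
  by have [y [? ? <-]] := resolvent_exists hA x ltr01; exists y; rewrite /P scale1r.
have /choice[N hN] x : exists y, E y /\ P y = Q x by apply: P_onto.
have EN x : E (N x) by case: (hN x).
have PN x : P (N x) = Q x by case: (hN x).
(* The family is the image under N of the unit ball of [E], written with explicit scalars because N
   comes from choice and its linearity is not proved. With x = Pv, <x, a N y> = <Qv, a y>, of
   modulus at most |Qv|. *)
have [C hC] : exists C, forall w,
    (exists a y, [/\ E y, sq (a *: y) <= 1 & w = a *: N y]) -> sq w <= C.
  apply: weakly_bounded => x; have [v [ev <-]] := P_onto x.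
  exists (sq (Q v)) => _ [a [y [ey y1 ->]]].
  rewrite ripZr P_sym // PN -Q_sym // -ripZr.
  apply: le_trans (cauchy_schwarz _ _) _.
  by rewrite -[leRHS]mulr1 ler_wpM2l ?rip_ge0.
have C0 : 0 <= C.
  rewrite -(rip0l 0); apply: hC; exists 0, 0; split; rewrite ?scale0r ?rip0l //.
  by split; rewrite ?(saO hA); apply: (sa_0 hA).
pose K := Num.sqrt (C + 1).
have KE : K ^+ 2 = C + 1 by rewrite sqr_sqrtr //; lra.
have K0 : 0 < K by rewrite sqrtr_gt0; lra.
have N_bd x : E x -> sq (N x) <= K ^+ 2 * sq x.
  (* At x = 0 normalisation fails; there |N 0|^2 + |A N 0|^2 = <Q 0, N 0> = 0. *)
  move=> ex; have := rip_ge0 hV x; rewrite le_eqVlt => /predU1P[x0|x0].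
    have xE : x = 0 by apply: (rip_def hV).
    have := P_rip _ _ (EN x) (proj1 (EN x)); rewrite PN Q_rip // -x0 mulr0.
    rewrite [in rip x _]xE [in B x]xE (saO hB) !rip0l addr0.
    have := rip_ge0 hV (A (N x)); lra.
  have n0 : 0 < nrm x by rewrite sqrtr_gt0.
  rewrite KE -ler_pdivrMr //; apply: (@le_trans _ _ C); last by lra.
  have i2 : (nrm x)^-1 * (nrm x)^-1 = (sq x)^-1 by rewrite -invfM -expr2 nrm_sqr.
  have := hC ((nrm x)^-1 *: N x); rewrite ripZl ripZr mulrA i2 mulrC; apply.
  exists (nrm x)^-1, x; split=> //.
  by rewrite ripZl ripZr mulrA i2 mulVf // lt0r_neq0.
exists K => [|x dx dAx]; first exact: ltW.
have ex : E x by [].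
(* Since PN = Q, the form bound on N is the claimed comparison of <Qx, x> with <Px, x>. *)
have : rip (P (N x)) x <= K * rip (P x) x.
  apply: (@krein E P) => // [a y z ey ez|y z ey ez]; first exact: square_lin.
  by rewrite PN Q_sym // -PN P_sym.
by rewrite PN Q_rip // P_rip.
Qed.

(** Approximate x in the graph norm of A by u_n in D(A^2); by the form bound B u_n is Cauchy, and B
    is closed. *)
Lemma dom_of_square x : DA x -> DB x.
Proof.
move=> dx; have [C C0 hC] := square_form_bound.
have /choice[u hu] n : exists y,
    [/\ DA y, DA (A y), sq (y - x) < n.+1%:R^-1 & sq (A y - A x) < n.+1%:R^-1].
  by apply: (square_core hA) => //; rewrite invr_gt0 ltr0n.
have bd m n : sq (B (u m) - B (u n)) <= 4 * C * (m.+1%:R^-1 + n.+1%:R^-1).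
  have [dm dAm m1 m2] := hu m; have [dn dAn n1 n2] := hu n.
  have [dBm _] := sAB dm dAm; have [dBn _] := sAB dn dAn.
  have [d1 e1] := saB hA dm dn; have [d2 e2] := saB hA dAm dAn.
  have [_ <-] := saB hB dBm dBn.
  have := hC _ d1; rewrite e1 => /(_ d2).
  have := sqB_le x (u m) (u n); have := sqB_le (A x) (A (u m)) (A (u n)).
  have := rip_ge0 hV (u m - u n).
  move: m1 m2 n1 n2; set p := m.+1%:R^-1; set q := n.+1%:R^-1.
  move=> m1 m2 n1 n2 h1 h2 h3 h4.
  have : C * (sq (u m - u n) + sq (A (u m) - A (u n))) <= C * (4 * (p + q)).
    by apply: ler_wpM2l => //; lra.
  lra.
have [y hy] := cauchy_rate (mulr_ge0 (ler0n R 4) C0) bd.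
have [//] : DB x /\ B x = y.
apply: (sa_closed hB) => e e0; have [N1 h1] := hy _ e0.
have [N2 h2] := inv_nat_small e0; pose n := (N1 + N2)%N.
have [d dA l _] := hu n; exists (u n); split; first by have [] := sAB d dA.
  by apply: lt_trans l _; apply: h2; rewrite leq_addl.
by apply: h1; rewrite leq_addr.
Qed.

End Inclusion.

(** Write w = v + A^2 v; orthogonality to v gives |v|^2 + |Av|^2 = 0. *)
Lemma square_dense (D : V -> Prop) (A : V -> V) : is_self_adjoint D A ->
  forall w, (forall y, D y -> D (A y) -> rip w y = 0) -> w = 0.
Proof.
move=> hA w hw; have [v [dv dAv]] := resolvent_exists hA w ltr01.
rewrite scale1r => wE; have := hw v dv dAv; rewrite -wE (square_rip hA) // => h.
have v0 : v = 0.
  by apply: (rip_def hV); have := rip_ge0 hV v; have := rip_ge0 hV (A v); lra.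
by rewrite v0 !(saO hA) addr0.
Qed.

(** * Anticommuting operators with equal squares, one of them positive *)

Lemma anticommuting_positive_eq0 (DA DB : V -> Prop) (A B : V -> V) :
  is_self_adjoint DA A -> is_self_adjoint DB B ->
  (forall x, DA x -> 0 <= rip (A x) x) ->
  (forall x, DA x -> DA (A x) ->
     [/\ DB x, DB (B x), DB (A x), DA (B x) &
         A (A x) = B (B x) /\ A (B x) = - B (A x)]) ->
  forall x, [/\ DA x, DB x, A x = 0 & B x = 0].
Proof.
move=> hA hB A_ge0 hAB.
have AA0 x : DA x -> DA (A x) -> A (A x) = 0.
  move=> dx dAx; have [dBx dBBx dBAx dABx [eAA eAB]] := hAB x dx dAx.
  have Au : rip (A (A x)) (A x) = 0.
    apply/le_anti/andP; split; last exact: A_ge0.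
    have := A_ge0 _ dABx; rewrite eAB ripNl (sa_sym hB dBAx dBBx) -eAA.
    by rewrite (rip_sym hV (A x)); lra.
  (* For u = Ax, Cauchy-Schwarz for the form of A gives <Au, h>^2 <= <Au, u> <Ah, h> = 0. *)
  apply: (orth_dense hA) => h dh; rewrite (rip_sym hV h) (rip_sym hV h) rip0l.
  apply/eqP; rewrite -sqrf_eq0 eq_le sqr_ge0 andbT.
  have := form_cauchy_schwarz (sa_lin hA) (sa_sym hA) A_ge0 dAx dh.
  by rewrite Au mul0r.
(* As A^2 v = 0, the equation v + A^2 v = x says v = x, so every x lies in D(A^2). *)
move=> x; have [v [dv dAv]] := resolvent_exists hA x ltr01.
rewrite AA0 // scaler0 addr0 => vx; rewrite vx in dv dAv.
have [dBx dBBx _ _ [eAA _]] := hAB x dv dAv.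
split=> //; apply: (rip_def hV).
  by rewrite -(sa_sym hA) // AA0 // rip0l.
by rewrite -(sa_sym hB) // -eAA AA0 // rip0l.
Qed.

End RealHilbert.

(** * A complex Hilbert space seen as a real one *)

Import complex.

(** An alias that carries the action of the real scalars, apart from the complex module structure of
    [H]. *)
Definition realification (R : realType) (H : lmodType R[i]) : Type := H.

Section Realification.
Local Open Scope complex_scope.
Variables (R : realType) (H : lmodType R[i]).

HB.instance Definition _ := GRing.Zmodule.copy (realification H) H.

Definition real_scale (a : R) (x : realification H) : realification H :=
  a%:C *: (x : H).

Lemma real_scaleA a b x : real_scale a (real_scale b x) = real_scale (a * b) x.
Proof. by rewrite /real_scale scalerA rmorphM. Qed.
Lemma real_scale1 : left_id 1 real_scale.
Proof. by move=> x; rewrite /real_scale rmorph1 scale1r. Qed.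
Lemma real_scaleDr : right_distributive real_scale +%R.
Proof. by move=> a x y; rewrite /real_scale scalerDr. Qed.
Lemma real_scaleDl x : {morph real_scale^~ x : a b / a + b}.
Proof. by move=> a b; rewrite /real_scale rmorphD scalerDl. Qed.

HB.instance Definition _ := GRing.Zmodule_isLmodule.Build R (realification H)
  real_scaleA real_scale1 real_scaleDr real_scaleDl.

Lemma real_scaleE (a : R) (x : realification H) : a *: x = a%:C *: (x : H).
Proof. by []. Qed.

Variable ip : H -> H -> R[i].
Hypothesis hH : is_hilbert ip.

Definition re_ip (x y : realification H) : R := complex.Re (ip x y).

Lemma ipDl x y z : ip (x + y) z = ip x z + ip y z.
Proof. by have := ip_linl hH 1 x y z; rewrite scale1r mul1r. Qed.
Lemma ip0l z : ip 0 z = 0.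
Proof.
have := ipDl 0 0 z; rewrite addr0 => /eqP.
by rewrite -subr_eq subrr => /eqP.
Qed.
Lemma ipZl a x z : ip (a *: x) z = a * ip x z.
Proof. by have := ip_linl hH a x 0 z; rewrite addr0 ip0l addr0. Qed.

Lemma Re_imag_unitM z : complex.Re (imag_unit R * z) = - complex.Im z.
Proof. by case: z => a b /=; rewrite mul0r mul1r sub0r. Qed.

Lemma re_ip_imag_unitl x y :
  re_ip (imag_unit R *: (x : H)) y = - complex.Im (ip x y).
Proof. by rewrite /re_ip ipZl Re_imag_unitM. Qed.

(** Multiplication by i is skew for the real form; this separates F from iG later. *)
Lemma re_ip_imag_unitr x y : re_ip x (imag_unit R *: (y : H)) =
  - re_ip (imag_unit R *: (x : H)) y.
Proof.
rewrite re_ip_imag_unitl /re_ip (ip_conj hH) ipZl (ip_conj hH x y).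
by case: (ip x y) => a b /=; rewrite mul0r mul1r sub0r !opprK.
Qed.

Lemma re_ip_hilbert : is_real_hilbert re_ip.
Proof.
split.
- move=> a x y z; rewrite /re_ip real_scaleE (ip_linl hH).
  by case: (ip x z) => b c; case: (ip y z) => d e /=; rewrite mul0r subr0.
- by move=> x y; rewrite /re_ip (ip_conj hH y x); case: (ip y x).
- by move=> x; have := ip_pos hH x; rewrite lecE => /andP[].
- move=> x; rewrite /re_ip => hx; apply: (ip_def hH); have := ip_pos hH x.
  by rewrite lecE => /andP[/eqP h _]; move: hx h; case: (ip x x) => a b /= -> ->.
- by move=> u hu; have [l hl] := ip_complete hH hu; exists l.
Qed.

Lemma re_ip_self_adjoint (A : op H) : self_adjoint ip A ->
  is_self_adjoint re_ip (dom A) (app A).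
Proof.
move=> [[A0 A_lin] [A_dense [A_adj A_sym]]]; split=> //.
- by move=> a x y dx dy; apply: A_lin.
- by move=> x e /(A_dense x)[y [? ?]]; exists y.
- by move=> x y dx dy; rewrite /re_ip A_sym.
- move=> y z hz; apply/A_adj; exists z => x dx; apply/eqP; rewrite eq_complex.
  apply/andP; split; apply/eqP; first exact: hz.
  (* The real parts agree by hypothesis; testing with ix in place of x gives the imaginary parts. *)
  have [_] := A_lin 1 0 0 A0 A0.
  rewrite !scale1r addr0 => /eqP; rewrite -subr_eq subrr => /eqP Az.
  have := A_lin (imag_unit R) x 0 dx A0; rewrite -Az !addr0 => -[dix eix].
  by apply: oppr_inj; rewrite -!re_ip_imag_unitl -(hz _ dix) eix.
Qed.

End Realification.

(** * Separation of the two symmetric parts of T^2 *)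

Theorem theorem2p10 (R : realType) (H : lmodType R[i]) (ip : H -> H -> R[i])
  (hH : is_hilbert ip) (A B : op H)
  (hA : self_adjoint ip A) (hB : self_adjoint ip B)
  (hpos : positive_op ip A \/ positive_op ip B)
  (hdom : forall x, dom (op_mul A A) x <-> dom (op_mul B B) x) :
  let T := op_add A (op_scale (imag_unit R) B) in
  (forall x, dom (op_mul T T) x -> app T (app T x) = 0) ->
  forall x, dom T x /\ app T x = 0.
Proof.
move=> T hT; pose i := imag_unit R.
have ii : i * i = -1.
  apply/eqP; rewrite /i eq_complex /=.
  by apply/andP; split; apply/eqP; ring.
have hV := re_ip_hilbert hH.
have sA := re_ip_self_adjoint hH hA; have sB := re_ip_self_adjoint hH hB.
have AB x : dom A x -> dom B x.
  apply: (dom_of_square hV sA sB) => y dy dAy.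
  exact: (proj1 (hdom y) (conj dy dAy)).
have BA x : dom B x -> dom A x.
  apply: (dom_of_square hV sB sA) => y dy dBy.
  exact: (proj2 (hdom y) (conj dy dBy)).
pose F x := app A (app A x) - app B (app B x).
pose G x := app A (app B x) + app B (app A x).
have [[A0 A_lin] _] := hA; have [[B0 B_lin] _] := hB.
have A_app a x : dom A x -> dom A (a *: x) /\ app A (a *: x) = a *: app A x.
  by move=> dx; have := A_lin a x 0 dx A0; rewrite (saO sA) !addr0.
have B_app a x : dom B x -> dom B (a *: x) /\ app B (a *: x) = a *: app B x.
  by move=> dx; have := B_lin a x 0 dx B0; rewrite (saO sB) !addr0.
(* Since D(A) = D(B), all four products of A and B are defined on D(A^2). *)
have dE x : dom A x -> dom A (app A x) ->
    [/\ dom B x, dom B (app B x), dom B (app A x) & dom A (app B x)].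
  move=> dx dAx; have [dBx dBBx] := proj1 (hdom x) (conj dx dAx).
  by split=> //; [apply: AB | apply: BA].
have FG x : dom A x -> dom A (app A x) -> F x + i *: G x = 0.
  move=> dx dAx; have [dBx dBBx dBAx dABx] := dE x dx dAx.
  have [d1 e1] := A_lin i _ _ dABx dAx.
  have [d2 e2] := B_lin i _ _ dBBx dBAx.
  have := hT x; rewrite /= -/i (addrC (app A x)) e1 e2 => h.
  have {h} : i *: app A (app B x) + app A (app A x)
      + i *: (i *: app B (app B x) + app B (app A x)) = 0.
    by apply: h.
  rewrite scalerDr scalerA ii scaleN1r => <-.
  by rewrite /F /G scalerDr (addrC _ (app A (app A x))) addrACA.
have F_sym x y : dom A x -> dom A (app A x) -> dom A y -> dom A (app A y) ->
    re_ip ip (F x) y = re_ip ip x (F y).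
  move=> dx dAx dy dAy; have [? ? ? ?] := dE x dx dAx.
  have [? ? ? ?] := dE y dy dAy.
  by rewrite /F (ripBl hV) (ripBr hV) !(sa_sym sA) // !(sa_sym sB).
have G_sym x y : dom A x -> dom A (app A x) -> dom A y -> dom A (app A y) ->
    re_ip ip (G x) y = re_ip ip x (G y).
  move=> dx dAx dy dAy; have [? ? ? ?] := dE x dx dAx.
  have [? ? ? ?] := dE y dy dAy.
  rewrite /G (ripDl hV) (ripDr hV) addrC; congr (_ + _).
    by rewrite (sa_sym sB) ?(sa_sym sA).
  by rewrite (sa_sym sA) ?(sa_sym sB).
(* Commuting with i makes iG skew for [re_ip], while F = - iG is symmetric. *)
have G_imag x : dom A x -> dom A (app A x) -> G (i *: x) = i *: G x.
  move=> dx dAx; have [dBx dBBx dBAx dABx] := dE x dx dAx.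
  have [_ e1] := A_app i _ dx; have [_ e2] := B_app i _ dBx.
  have [_ e3] := A_app i _ dABx; have [_ e4] := B_app i _ dBAx.
  by rewrite /G e1 e2 e3 e4 scalerDr.
have F0 x : dom A x -> dom A (app A x) -> F x = 0.
  move=> dx dAx; apply: (square_dense hV sA) => y dy dAy.
  have [diy eiy] := A_app i _ dy; have [diAy _] := A_app i _ dAy.
  have F_G z : dom A z -> dom A (app A z) -> F z = - (i *: G z).
    by move=> dz dAz; apply/eqP; rewrite -addr_eq0 FG.
  (* <Fx, y> = <-iGx, y> = <Gx, iy> = <x, iGy> = -<x, Fy> *)
  have : re_ip ip (F x) y = - re_ip ip (F x) y.
    rewrite {1}F_G // (ripNl hV) -(re_ip_imag_unitr hH) G_sym // ?eiy //.
    by rewrite G_imag // -[i *: G y]opprK -F_G // (ripNr hV) F_sym.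
  by lra.
(* With F = 0 there remains iG = 0, and G = - i (iG). *)
have G0 x : dom A x -> dom A (app A x) -> G x = 0.
  move=> dx dAx; have := FG x dx dAx; rewrite F0 // add0r => iG.
  by rewrite -[G x]scale1r -[1]opprK -ii scaleNr -scalerA iG scaler0 oppr0.
have key x : dom A x -> dom A (app A x) ->
   [/\ app A (app A x) = app B (app B x), app A (app B x) = - app B (app A x)
     & app B (app A x) = - app A (app B x)].
  move=> dx dAx; split; apply/eqP.
  - by rewrite -subr_eq0 -/(F x) F0.
  - by rewrite -addr_eq0 -/(G x) G0.
  - by rewrite -addr_eq0 addrC -/(G x) G0.
suff zero x : [/\ dom A x, dom B x, app A x = 0 & app B x = 0].
  by move=> x; have [? ? a0 b0] := zero x; rewrite /= a0 b0 scaler0 addr0.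
case: hpos => [pA|pB].
  apply: (anticommuting_positive_eq0 hV sA sB) => [y dy|y dy dAy].
    by have := pA y dy; rewrite lecE => /andP[].
  by have [? ? ? ?] := dE y dy dAy; have [? ? _] := key y dy dAy.
(* When B is the positive operator, A and B exchange roles. *)
have [] : [/\ dom B x, dom A x, app B x = 0 & app A x = 0]; last by [].
apply: (anticommuting_positive_eq0 hV sB sA) => [y dy|y dy dBy].
  by have := pB y dy; rewrite lecE => /andP[].
have [dAy dAAy] := proj2 (hdom y) (conj dy dBy).
by have [? ? ? ?] := dE y dAy dAAy; have [? _ ?] := key y dAy dAAy.
Qed.
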